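(* Let $(\mathcal{M},g,\overset{1}{\nabla})$ be an $n$-dimensional ($n\ge3$) GRW space-time with a semi-symmetric metric $P$-connection, $P$ unit timelike, which is a perfect fluid space-time, i.e. $\overset{g}{Ric}=a\,g+b\,\pi\otimes\pi$ for some scalars (functions) $a,b$. Then $(\mathcal{M},g)$ is a Ricci pseudo-symmetric manifold of constant type, satisfying $$\overset{g}{\mathcal{R}}\cdot\overset{g}{Ric}=Q(g,\overset{g}{Ric}).$$
   Context: Setting: $(\mathcal{M},g)$ is a Lorentzian manifold of signature $(-,+,\dots,+)$ with Levi-Civita connection $\overset{g}{\nabla}$; $P$ is a vector field with $g(P,P)=-1$, and $\pi(\cdot)=g(\cdot,P)$. The connection $\overset{1}{\nabla}_XY=\overset{g}{\nabla}_XY+\pi(Y)X-g(X,Y)P$ is a semi-symmetric metric $P$-connection, i.e. $\overset{1}{\nabla}P=0$; equivalently $\overset{g}{\nabla}_XP=X+\pi(X)P$ for all $X$. Such a manifold is a generalized Robertson-Walker (GRW) space-time (locally a warped product with metric $-(\mathrm dt)^2+f(t)^2g^*$, $g^*$ Riemannian). $\overset{g}{R}(X,Y)Z=\overset{g}{\nabla}_X\overset{g}{\nabla}_YZ-\overset{g}{\nabla}_Y\overset{g}{\nabla}_XZ-\overset{g}{\nabla}_{[X,Y]}Z$ and $\overset{g}{Ric}(Y,Z)=\mathrm{tr}(X\mapsto\overset{g}{R}(X,Y)Z)$. For a $(0,2)$-tensor $B$: $(\overset{g}{\mathcal{R}}\cdot B)(U,V;X,Y)=-B(\overset{g}{R}(X,Y)U,V)-B(U,\overset{g}{R}(X,Y)V)$,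 and $Q(g,B)(U,V;X,Y)=-B((X\wedge_gY)U,V)-B(U,(X\wedge_gY)V)$, where $(X\wedge_gY)Z=g(Y,Z)X-g(X,Z)Y$. A manifold is Ricci pseudo-symmetric if $\overset{g}{\mathcal{R}}\cdot\overset{g}{Ric}=f_2\,Q(g,\overset{g}{Ric})$ with $f_2$ a function on the set $\{x\in\mathcal M: Q(g,\overset{g}{Ric})(x)\neq0\}$, and of constant type if $f_2$ is constant. *)

(* Defs.v *)
From HB Require Import structures.
From mathcomp Require Import all_boot all_order all_algebra.
From mathcomp Require Import all_classical all_reals all_analysis.
From mathcomp Require Import ring.
Set Implicit Arguments.
Unset Strict Implicit.
Unset Printing Implicit Defensive.
Import Order.TTheory GRing.Theory Num.Theory.
Import numFieldNormedType.Exports.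
Local Open Scope classical_set_scope.
Local Open Scope ring_scope.

Section SmoothOn.
Context {R : realType} {n : nat}.
Implicit Types (D : set 'rV[R]_n) (f g : 'rV[R]_n -> R).

Fixpoint Ck (k : nat) D f : Prop :=
  (forall x, D x -> {for x, continuous f}) /\
  if k is k'.+1 then
    forall i : 'I_n, (forall x, D x -> derivable f x (delta_mx 0 i)) /\
                     Ck k' D ('D_(delta_mx 0 i) f)
  else True.

(* Meaningful for open D only: the derivatives are those of f itself, not of
   its restriction to D. *)
Definition smooth_on D f : Prop := forall k, Ck k D f.

Lemma Ck_cont k D f x : Ck k D f -> D x -> {for x, continuous f}.
Proof. by case: k => [|k] [fc _]; exact: fc. Qed.

Lemma CkS k D f : Ck k.+1 D f -> Ck k D f.
Proof.
elim: k f => [|k IH] f [fc fd]; split => //.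
by move=> i; have [di Ci] := fd i; split => //; exact: IH.
Qed.

Lemma Ck_ext k D f g : open D -> (forall x, D x -> f x = g x) ->
  Ck k D f -> Ck k D g.
Proof.
move=> oD.
have nfg (u v : 'rV[R]_n -> R) x : (forall y, D y -> u y = v y) -> D x ->
    \forall y \near x, u y = v y.
  by move=> uv Dx; apply: filterS (open_nbhs_nbhs (conj oD Dx)) => y; exact: uv.
have ext_cont (u v : 'rV[R]_n -> R) x : (forall y, D y -> u y = v y) -> D x ->
    {for x, continuous u} -> {for x, continuous v}.
  move=> uv Dx uc; rewrite /prop_for /continuous_at -(uv _ Dx).
  exact: cvg_trans (near_eq_cvg (nfg u v x uv Dx)) uc.
elim: k f g => [|k IH] f g fg [fc fd]; split => //;
  try by move=> x Dx; exact: ext_cont fg Dx (fc _ Dx).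
move=> i; have [di Ci] := fd i; split=> [x Dx|].
  by apply: near_eq_derivable (di _ Dx); exact: nfg.
by apply: IH Ci => x Dx; apply: near_eq_derive; exact: nfg.
Qed.

Lemma Ck_cst k D (c : R) : Ck k D (cst c).
Proof.
elim: k c => [|k IH] c; split => //; try by move=> x _; exact: cst_continuous.
move=> i; split=> [x _|]; first exact: derivable_cst.
rewrite (_ : 'D_(delta_mx 0 i) (cst c) = cst 0) //.
by apply/funext => x; rewrite derive_cst.
Qed.

Lemma CkB k D f g : open D -> Ck k D f -> Ck k D g ->
  Ck k D (fun x => f x - g x).
Proof.
move=> oD; elim: k f g => [|k IH] f g [fc fd] [gc gd].
  by split => // x Dx; apply: continuousB; [exact: fc|exact: gc].
split=> [x Dx|i]; first by apply: continuousB; [exact: fc|exact: gc].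
have [fdi fCi] := fd i; have [gdi gCi] := gd i; split=> [x Dx|].
  exact: derivableB (fdi _ Dx) (gdi _ Dx).
apply: Ck_ext (IH _ _ fCi gCi) => // x Dx; symmetry.
exact: deriveB (fdi _ Dx) (gdi _ Dx).
Qed.

Lemma CkD k D f g : open D -> Ck k D f -> Ck k D g ->
  Ck k D (fun x => f x + g x).
Proof.
move=> oD fC gC.
apply: (Ck_ext oD _ (CkB oD fC (CkB oD (Ck_cst k D 0) gC))) => x _ /=.
by rewrite sub0r opprK.
Qed.

Lemma CkM k D f g : open D -> Ck k D f -> Ck k D g ->
  Ck k D (fun x => f x * g x).
Proof.
move=> oD; elim: k f g => [|k IH] f g fC gC.
  split => // x Dx.
  by apply: continuousM; [exact: Ck_cont fC Dx|exact: Ck_cont gC Dx].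
split=> [x Dx|i].
  by apply: continuousM; [exact: Ck_cont fC Dx|exact: Ck_cont gC Dx].
have [_ /(_ i)[fdi fCi]] := fC; have [_ /(_ i)[gdi gCi]] := gC.
split=> [x Dx|]; first exact: derivableM (fdi _ Dx) (gdi _ Dx).
apply: Ck_ext (CkD oD (IH _ _ (CkS fC) gCi) (IH _ _ (CkS gC) fCi)) => //.
by move=> x Dx; rewrite (deriveM (fdi _ Dx) (gdi _ Dx)).
Qed.

End SmoothOn.

(* [bwd] is the inverse of the coordinate map [fwd]; as a total function it is
   relevant on [cod] only. *)
Record chart (R : realType) (n : nat) (M : topologicalType) := Chart {
  dom : set M;
  cod : set 'rV[R]_n;
  fwd : M -> 'rV[R]_n;
  bwd : 'rV[R]_n -> M;
  dom_open : open dom;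
  cod_open : open cod;
  fwd_cod : forall p, dom p -> cod (fwd p);
  bwd_dom : forall x, cod x -> dom (bwd x);
  fwdK : forall p, dom p -> bwd (fwd p) = p;
  bwdK : forall x, cod x -> fwd (bwd x) = x;
  fwd_cont : forall p, dom p -> {for p, continuous fwd};
  bwd_cont : forall x, cod x -> {for x, continuous bwd}
}.

Arguments dom_open {R n M} c.
Arguments cod_open {R n M} c.

Record smoothManifold (R : realType) (n : nat) := SmoothManifold {
  carrier :> topologicalType;
  carrier_hausdorff : hausdorff_space carrier;
  carrier_second_countable : @second_countable carrier;
  atlas : set (chart R n carrier);
  atlas_cover : forall p, exists2 c, atlas c & dom c p;
  atlas_compat : forall c c', atlas c -> atlas c' ->
    forall i : 'I_n,
      smooth_on [set x | cod c x /\ dom c' (bwd c x)]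
                (fun x => fwd c' (bwd c x) 0 i)
}.

Definition smooth (R : realType) (n : nat) (M : smoothManifold R n)
    (f : M -> R) : Prop :=
  forall c, atlas c -> smooth_on (cod c) (fun x => f (bwd c x)).

Section Cinf.
Context {R : realType} {n : nat} (M : smoothManifold R n).

Definition smooth_pred : {pred M -> R} := [pred f | `[< smooth f >]].

Lemma smooth_subring_closed : subring_closed smooth_pred.
Proof.
split.
- by apply/asboolP => c _ k; exact: Ck_cst.
- move=> f g /asboolP fs /asboolP gs; apply/asboolP => c Ac k.
  by have := CkB (cod_open c) (fs c Ac k) (gs c Ac k).
- move=> f g /asboolP fs /asboolP gs; apply/asboolP => c Ac k.
  by have := CkM (cod_open c) (fs c Ac k) (gs c Ac k).
Qed.

HB.instance Definition _ :=
  GRing.isSubringClosed.Build (M -> R) smooth_pred smooth_subring_closed.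

Record Cinf := MkCinf {
  Cinf_fun :> M -> R;
  Cinf_smooth : smooth_pred Cinf_fun
}.

HB.instance Definition _ := [isSub for Cinf_fun].
HB.instance Definition _ := [Choice of Cinf by <:].
HB.instance Definition _ := GRing.SubChoice_isSubComPzRing.Build
  (M -> R) smooth_pred Cinf smooth_subring_closed.

Definition toCinf (f : M -> R) (fs : smooth f) : Cinf := MkCinf (asboolT fs).

Lemma Cinf_smoothP (f : Cinf) : smooth f.
Proof. by apply/asboolP; exact: Cinf_smooth. Qed.

Lemma Cinf_ext (f g : Cinf) : (forall p, f p = g p) -> f = g.
Proof. by move=> fg; apply/val_inj/funext. Qed.

Lemma smooth_cst (c : R) : smooth (fun _ : M => c).
Proof. by move=> ch _ k; exact: Ck_cst. Qed.

Definition Cinf_scale (c : R) (f : Cinf) : Cinf := toCinf (smooth_cst c) * f.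

Fact Cinf_scalerA a b f : Cinf_scale a (Cinf_scale b f) = Cinf_scale (a * b) f.
Proof. by apply: Cinf_ext => p; exact: mulrA. Qed.
Fact Cinf_scale1r : left_id 1 Cinf_scale.
Proof. by move=> f; apply: Cinf_ext => p; exact: mul1r. Qed.
Fact Cinf_scalerDr : right_distributive Cinf_scale +%R.
Proof. by move=> a f g; apply: Cinf_ext => p; exact: mulrDr. Qed.
Fact Cinf_scalerDl f : {morph Cinf_scale^~ f : a b / a + b}.
Proof. by move=> a b; apply: Cinf_ext => p; exact: mulrDl. Qed.
HB.instance Definition _ := GRing.Zmodule_isLmodule.Build R Cinf
  Cinf_scalerA Cinf_scale1r Cinf_scalerDr Cinf_scalerDl.

Lemma CinfDE (f g : Cinf) p : (f + g) p = f p + g p. Proof. by []. Qed.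
Lemma CinfNE (f : Cinf) p : (- f) p = - f p. Proof. by []. Qed.
Lemma CinfME (f g : Cinf) p : (f * g) p = f p * g p. Proof. by []. Qed.
Lemma CinfZE c (f : Cinf) p : (c *: f) p = c * f p. Proof. by []. Qed.
Lemma Cinf0E p : (0 : Cinf) p = 0. Proof. by []. Qed.
Lemma Cinf1E p : (1 : Cinf) p = 1. Proof. by []. Qed.

End Cinf.

Arguments toCinf {R n M f}.

Section Tangent.
Context {R : realType} {n : nat} {M : smoothManifold R n} (p : M).

(* Tangent vectors at [p] are the derivations of C^oo(M) at [p]. *)
Record tangent := Tangent {
  tangent_fun :> Cinf M -> R;
  tangent_linear : scalar tangent_fun;
  tangent_leibniz : forall f g : Cinf M,
    tangent_fun (f * g) = tangent_fun f * g p + f p * tangent_fun g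
}.

HB.instance Definition _ := gen_eqMixin tangent.
HB.instance Definition _ := gen_choiceMixin tangent.

Lemma tangent_ext (v w : tangent) : (forall f, v f = w f) -> v = w.
Proof.
case: v => v vl vL; case: w => w wl wL /= /funext vw.
by case: _ / vw in wl wL *; congr Tangent; exact: Prop_irrelevance.
Qed.

Program Definition tangent0 := @Tangent (fun=> 0) _ _.
Next Obligation. by move=> c f g; ring. Qed.
Next Obligation. by move=> f g; rewrite mul0r mulr0 addr0. Qed.

Program Definition tangent_opp (v : tangent) := @Tangent (fun f => - v f) _ _.
Next Obligation. by move=> v c f g; rewrite [LHS]/= tangent_linear; ring. Qed.
Next Obligation. by move=> v f g; rewrite [LHS]/= tangent_leibniz; ring. Qed.

Program Definition tangent_add (v w : tangent) :=
  @Tangent (fun f => v f + w f) _ _.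
Next Obligation.
by move=> v w c f g; rewrite [LHS]/= !tangent_linear; ring.
Qed.
Next Obligation. by move=> v w f g; rewrite [LHS]/= !tangent_leibniz; ring. Qed.

Program Definition tangent_scale (k : R) (v : tangent) :=
  @Tangent (fun f => k * v f) _ _.
Next Obligation.
by move=> k v c f g; rewrite [LHS]/= !tangent_linear; ring.
Qed.
Next Obligation. by move=> k v f g; rewrite [LHS]/= !tangent_leibniz; ring. Qed.

Fact tangent_addA : associative tangent_add.
Proof. by move=> u v w; apply: tangent_ext => f; exact: addrA. Qed.
Fact tangent_addC : commutative tangent_add.
Proof. by move=> u v; apply: tangent_ext => f; exact: addrC. Qed.
Fact tangent_add0 : left_id tangent0 tangent_add.
Proof. by move=> u; apply: tangent_ext => f; exact: add0r. Qed.
Fact tangent_addN : left_inverse tangent0 tangent_opp tangent_add.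
Proof. by move=> u; apply: tangent_ext => f; exact: addNr. Qed.
HB.instance Definition _ := GRing.isZmodule.Build tangent
  tangent_addA tangent_addC tangent_add0 tangent_addN.

Fact tangent_scalerA a b v :
  tangent_scale a (tangent_scale b v) = tangent_scale (a * b) v.
Proof. by apply: tangent_ext => f; exact: mulrA. Qed.
Fact tangent_scale1r : left_id 1 tangent_scale.
Proof. by move=> v; apply: tangent_ext => f; exact: mul1r. Qed.
Fact tangent_scalerDr : right_distributive tangent_scale +%R.
Proof. by move=> a v w; apply: tangent_ext => f; exact: mulrDr. Qed.
Fact tangent_scalerDl v : {morph tangent_scale^~ v : a b / a + b}.
Proof. by move=> a b; apply: tangent_ext => f; exact: mulrDl. Qed.
HB.instance Definition _ := GRing.Zmodule_isLmodule.Build R tangent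
  tangent_scalerA tangent_scale1r tangent_scalerDr tangent_scalerDl.

Definition is_basis (e : 'I_n -> tangent) : Prop :=
  forall v, exists! c : 'rV[R]_n, v = \sum_(i < n) c 0 i *: e i.

Definition is_trace (L : {linear tangent -> tangent}) (t : R) : Prop :=
  exists (e : 'I_n -> tangent) (A : 'M[R]_n),
    [/\ is_basis e,
        forall j, L (e j) = \sum_(i < n) A i j *: e i
      & t = \tr A].

End Tangent.

Arguments tangent {R n M} p.

Section VectorField.
Context {R : realType} {n : nat} (M : smoothManifold R n).

Record vectorField := VectorField {
  vf_at :> forall p : M, tangent p;
  vf_smooth : forall f : Cinf M, smooth (fun p => vf_at p f)
}.

HB.instance Definition _ := gen_eqMixin vectorField.
HB.instance Definition _ := gen_choiceMixin vectorField.

Lemma vf_ext (X Y : vectorField) : (forall p f, X p f = Y p f) -> X = Y.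
Proof.
case: X => X Xs; case: Y => Y Ys /= XY.
have {}XY : X = Y by apply: functional_extensionality_dep => p;
  apply: tangent_ext => f; exact: XY.
by case: _ / XY in Ys *; congr VectorField; exact: Prop_irrelevance.
Qed.

Definition vf_app (X : vectorField) (f : Cinf M) : Cinf M :=
  toCinf (vf_smooth X f).

Program Definition vf0 := @VectorField (fun p => 0) _.
Next Obligation. by move=> f; exact: Cinf_smoothP (0 : Cinf M). Qed.

Program Definition vf_opp (X : vectorField) := @VectorField (fun p => - X p) _.
Next Obligation. by move=> X f; exact: Cinf_smoothP (- vf_app X f). Qed.

Program Definition vf_add (X Y : vectorField) :=
  @VectorField (fun p => X p + Y p) _.
Next Obligation.
by move=> X Y f; exact: Cinf_smoothP (vf_app X f + vf_app Y f).
Qed.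

Program Definition vf_scale (h : Cinf M) (X : vectorField) :=
  @VectorField (fun p => h p *: X p) _.
Next Obligation. by move=> h X f; exact: Cinf_smoothP (h * vf_app X f). Qed.

Fact vf_addA : associative vf_add.
Proof. by move=> X Y Z; apply: vf_ext => p f; exact: addrA. Qed.
Fact vf_addC : commutative vf_add.
Proof. by move=> X Y; apply: vf_ext => p f; exact: addrC. Qed.
Fact vf_add0 : left_id vf0 vf_add.
Proof. by move=> X; apply: vf_ext => p f; exact: add0r. Qed.
Fact vf_addN : left_inverse vf0 vf_opp vf_add.
Proof. by move=> X; apply: vf_ext => p f; exact: addNr. Qed.
HB.instance Definition _ := GRing.isZmodule.Build vectorField
  vf_addA vf_addC vf_add0 vf_addN.

Fact vf_scalerA a b X : vf_scale a (vf_scale b X) = vf_scale (a * b) X.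
Proof. by apply: vf_ext => p f; exact: mulrA. Qed.
Fact vf_scale1r : left_id 1 vf_scale.
Proof. by move=> X; apply: vf_ext => p f; exact: mul1r. Qed.
Fact vf_scalerDr : right_distributive vf_scale +%R.
Proof. by move=> a X Y; apply: vf_ext => p f; exact: mulrDr. Qed.
Fact vf_scalerDl X : {morph vf_scale^~ X : a b / a + b}.
Proof. by move=> a b; apply: vf_ext => p f; exact: mulrDl. Qed.
HB.instance Definition _ := GRing.Zmodule_isLmodule.Build (Cinf M) vectorField
  vf_scalerA vf_scale1r vf_scalerDr vf_scalerDl.

Lemma vfDE (X Y : vectorField) p : (X + Y) p = X p + Y p. Proof. by []. Qed.
Lemma vfNE (X : vectorField) p : (- X) p = - X p. Proof. by []. Qed.
Lemma vfZE h (X : vectorField) p : (h *: X) p = h p *: X p. Proof. by []. Qed.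

Lemma vf_appD X f g : vf_app X (f + g) = vf_app X f + vf_app X g.
Proof.
apply: Cinf_ext => p /=.
by have := tangent_linear (X p) 1 f g; rewrite scale1r mul1r.
Qed.

Lemma vf_appZ X c f : vf_app X (c *: f) = c *: vf_app X f.
Proof.
apply: Cinf_ext => p; rewrite CinfZE /=.
have X0 : X p 0 = 0.
  by have := tangent_linear (X p) (-1) 0 0; rewrite scaler0 addr0 mulN1r addNr.
by have := tangent_linear (X p) c f 0; rewrite addr0 X0 addr0.
Qed.

Lemma vf_appM X f g : vf_app X (f * g) = vf_app X f * g + f * vf_app X g.
Proof. by apply: Cinf_ext => p; rewrite /= tangent_leibniz. Qed.

Program Definition bracket_at (X Y : vectorField) (p : M) : tangent p :=
  @Tangent R n M p (fun f => X p (vf_app Y f) - Y p (vf_app X f)) _ _.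
Next Obligation.
by move=> X Y p c f g; rewrite !vf_appD !vf_appZ !tangent_linear; ring.
Qed.
Next Obligation.
move=> X Y p f g.
change (vf_app X (vf_app Y (f * g)) p - vf_app Y (vf_app X (f * g)) p =
  (vf_app X (vf_app Y f) p - vf_app Y (vf_app X f) p) * g p +
  f p * (vf_app X (vf_app Y g) p - vf_app Y (vf_app X g) p)).
by rewrite !(vf_appM, vf_appD) !CinfDE !CinfME; ring.
Qed.

Program Definition bracket (X Y : vectorField) : vectorField :=
  @VectorField (bracket_at X Y) _.
Next Obligation.
move=> X Y f.
exact: Cinf_smoothP (vf_app X (vf_app Y f) - vf_app Y (vf_app X f)).
Qed.

End VectorField.

Arguments vectorField {R n} M.

(* The signature is (-,+,...,+): the first vector of a suitable basis of each
   tangent space is timelike, the others are spacelike. *)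
Record lorentzMetric (R : realType) (n : nat) (M : smoothManifold R n) :=
  LorentzMetric {
  lmetric_at :> forall p : M, tangent p -> tangent p -> R;
  lmetric_linear : forall p (w : tangent p),
    scalar (fun v : tangent p => lmetric_at v w);
  lmetric_sym : forall p (v w : tangent p), lmetric_at v w = lmetric_at w v;
  lmetric_smooth : forall X Y : vectorField M,
    smooth (fun p => lmetric_at (X p) (Y p));
  lmetric_signature : forall p, exists2 e : 'I_n -> tangent p, is_basis e &
    forall i j, lmetric_at (e i) (e j) =
      if i == j then (if i == 0%N :> nat then -1 else 1) else 0
}.

Section Geometry.
Context {R : realType} {n : nat} {M : smoothManifold R n}.
Implicit Types (X Y Z U V P : vectorField M) (g : lorentzMetric M).

Definition met g X Y : Cinf M := toCinf (lmetric_smooth g X Y).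

Record is_connection (nabla : vectorField M -> vectorField M -> vectorField M)
    : Prop := IsConnection {
  conn_linear : forall Y, linear (nabla ^~ Y);
  conn_add : forall X, {morph nabla X : Y Z / Y + Z};
  conn_leibniz : forall X Y (f : Cinf M),
    nabla X (f *: Y) = vf_app X f *: Y + f *: nabla X Y
}.

Record is_levi_civita g nabla : Prop := IsLeviCivita {
  lc_connection : is_connection nabla;
  lc_torsion_free : forall X Y, nabla X Y - nabla Y X = bracket X Y;
  lc_metric : forall X Y Z,
    vf_app X (met g Y Z) = met g (nabla X Y) Z + met g Y (nabla X Z)
}.

Definition curvature (nabla : vectorField M -> vectorField M -> vectorField M)
    X Y Z : vectorField M :=
  nabla X (nabla Y Z) - nabla Y (nabla X Z) - nabla (bracket X Y) Z.

(* (0,2)-tensor fields are represented by their values on vector fields. *)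
Definition tensor02 := vectorField M -> vectorField M -> M -> R.

(* Ric(Y,Z) = tr (X |-> R(X,Y)Z).  The set below is a singleton when [nabla] is
   a connection: by tensoriality R(X,Y)Z at [p] depends on [X] through [X p]
   only, every tangent vector at [p] extends to a vector field, and the trace
   does not depend on the basis. *)
Definition ricci nabla : tensor02 := fun Y Z p =>
  get [set t | exists2 L : {linear tangent p -> tangent p},
    forall X, L (X p) = curvature nabla X Y Z p & is_trace L t].

Definition Rdot nabla (B : tensor02) U V X Y (p : M) : R :=
  - B (curvature nabla X Y U) V p - B U (curvature nabla X Y V) p.

Definition wedge_endo g X Y Z : vectorField M := met g Y Z *: X - met g X Z *: Y.

Definition Qtensor g (B : tensor02) U V X Y (p : M) : R :=
  - B (wedge_endo g X Y U) V p - B U (wedge_endo g X Y V) p.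

Definition Qtensor_nonzero_at g (B : tensor02) (p : M) : Prop :=
  exists U V X Y, Qtensor g B U V X Y p <> 0.

(* The values of [f2] where Q(g,Ric) vanishes are irrelevant. *)
Definition ricci_pseudo_symmetric_with g nabla (f2 : M -> R) : Prop :=
  forall p, Qtensor_nonzero_at g (ricci nabla) p ->
  forall U V X Y, Rdot nabla (ricci nabla) U V X Y p =
                  f2 p * Qtensor g (ricci nabla) U V X Y p.

Definition ricci_pseudo_symmetric_constant_type g nabla : Prop :=
  exists2 f2 : M -> R, ricci_pseudo_symmetric_with g nabla f2 &
    exists c, forall p, Qtensor_nonzero_at g (ricci nabla) p -> f2 p = c.

(* The one-form written pi in the literature. *)
Definition dual_form g P Y : Cinf M := met g Y P.

(* The semi-symmetric metric connection determined by [P] and the Levi-Civita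
   connection [nabla]. *)
Definition semi_symmetric_conn g nabla P X Y : vectorField M :=
  nabla X Y + dual_form g P Y *: X - met g X Y *: P.

Definition unit_timelike g P : Prop := forall p, g p (P p) (P p) = -1.

Definition is_P_connection (nabla1 : vectorField M -> vectorField M ->
    vectorField M) P : Prop := forall X, nabla1 X P = 0.

Definition perfect_fluid g nabla P (a b : M -> R) : Prop :=
  forall Y Z p, ricci nabla Y Z p =
    a p * met g Y Z p + b p * (dual_form g P Y p * dual_form g P Z p).

End Geometry.

(* Main.v *)
Require Import Defs.
From mathcomp Require Import all_boot all_order all_algebra.
From mathcomp Require Import all_classical all_reals all_analysis.
From mathcomp Require Import ring.
Import GRing.Theory.
Local Open Scope ring_scope.

(** Both sides of the identity come from letting an endomorphism [T] of the
    tangent spaces, either [R(X,Y)] or [X /\ Y], act as a derivation on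
    [Ric = a g + b pi (x) pi].  Both endomorphisms are skew-adjoint for [g], so
    they kill the term [a g], and what is left depends on [T] only through the
    one-form [pi \o T]; this is [ricci_derivation].  It therefore
    suffices that [pi (R(X,Y)U) = pi ((X /\ Y)U)].

    By skew-adjointness, [pi (T U) = g(T U, P) = - g(U, T P)], so this reduces to
    [R(X,Y)P = (X /\ Y)P], i.e. [R(X,Y)P = pi(Y) X - pi(X) Y].  This last equation
    follows by differentiating [nabla_X P = X + pi(X) P], which says that [P] is
    parallel for the semi-symmetric connection: the torsion of [nabla] vanishes,
    and the remaining multiple [d pi(X,Y)] of [P] is zero because
    [g(nabla_X P, Y)] is symmetric in [X] and [Y]. *)

Section MetricAlgebra.
Context {R : realType} {n : nat} {M : smoothManifold R n}.
Implicit Types (X Y Z U V : vectorField M) (g : lorentzMetric M).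

Lemma met_sym g X Y : met g X Y = met g Y X.
Proof. by apply: Cinf_ext => p; exact: lmetric_sym. Qed.

Lemma metDl g X Y Z : met g (X + Y) Z = met g X Z + met g Y Z.
Proof.
apply: Cinf_ext => p; have /= := lmetric_linear g (Z p) 1 (X p) (Y p).
by rewrite scale1r mul1r.
Qed.

Lemma metZl g f X Z : met g (f *: X) Z = f * met g X Z.
Proof.
have met0 : met g 0 Z = 0.
  by apply: (addrI (met g 0 Z)); rewrite -metDl !addr0.
apply: Cinf_ext => p; have /= := lmetric_linear g (Z p) (f p) (X p) 0.
by rewrite addr0 => ->; have /(congr1 (fun h : Cinf M => h p)) /= -> := met0;
   rewrite addr0.
Qed.

Lemma metNl g X Z : met g (- X) Z = - met g X Z.
Proof. by rewrite -scaleN1r metZl mulN1r. Qed.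

Lemma metDr g X Y Z : met g Z (X + Y) = met g Z X + met g Z Y.
Proof. by rewrite met_sym metDl !(met_sym g Z). Qed.

Lemma metZr g f X Z : met g Z (f *: X) = f * met g Z X.
Proof. by rewrite met_sym metZl !(met_sym g Z). Qed.

Lemma metNr g X Z : met g Z (- X) = - met g Z X.
Proof. by rewrite met_sym metNl (met_sym g Z). Qed.

Definition metE := (metDl, metNl, metZl, metDr, metNr, metZr).

Lemma vf_app_bracket X Y (f : Cinf M) :
  vf_app (bracket X Y) f = vf_app X (vf_app Y f) - vf_app Y (vf_app X f).
Proof. exact: Cinf_ext. Qed.

Lemma wedge_skew g X Y U V :
  met g (wedge_endo g X Y U) V + met g U (wedge_endo g X Y V) = 0.
Proof.
rewrite /wedge_endo !metE (met_sym g U X) (met_sym g U Y); ring.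
Qed.

End MetricAlgebra.

Section LeviCivita.
Context {R : realType} {n : nat} {M : smoothManifold R n}.
Variables (g : lorentzMetric M).
Variable nabla : vectorField M -> vectorField M -> vectorField M.
Hypothesis nablaLC : is_levi_civita g nabla.
Implicit Types (X Y U V : vectorField M).

(** The second covariant derivatives of [g(U,V)] along [X] and [Y] have the same
    mixed terms in either order, so [X Y - Y X - [X,Y] = 0] applied to [g(U,V)]
    leaves only the curvature. *)
Lemma curvature_skew X Y U V :
  met g (curvature nabla X Y U) V + met g U (curvature nabla X Y V) = 0.
Proof.
have lc := lc_metric nablaLC.
have := vf_app_bracket X Y (met g U V).
rewrite !lc !vf_appD !lc => /eqP; rewrite -subr_eq0 => /eqP E.
by rewrite /curvature !metE -[RHS]oppr0 -E; ring.
Qed.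

End LeviCivita.

Section ParallelField.
Context {R : realType} {n : nat} {M : smoothManifold R n}.
Variables (g : lorentzMetric M).
Variable nabla : vectorField M -> vectorField M -> vectorField M.
Hypothesis nablaLC : is_levi_civita g nabla.
Variable P : vectorField M.
Hypothesis P_unit : unit_timelike g P.
Hypothesis P_parallel : is_P_connection (semi_symmetric_conn g nabla P) P.
Implicit Types (X Y U V : vectorField M).

Lemma nabla_parallel X : nabla X P = X + met g X P *: P.
Proof.
have PP : met g P P = -1 by apply: Cinf_ext => p; exact: P_unit.
have := P_parallel X; rewrite /semi_symmetric_conn /dual_form PP scaleN1r.
by move=> /eqP; rewrite subr_eq0 subr_eq addrC => /eqP.
Qed.

(** This is [d pi = 0], with the torsion-free connection eliminating the
    bracket. *)
Lemma dual_form_closed X Y :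
  met g (bracket X Y) P = vf_app X (met g Y P) - vf_app Y (met g X P).
Proof.
rewrite -(lc_torsion_free nablaLC) !(lc_metric nablaLC).
rewrite !nabla_parallel !metE (met_sym g Y X); ring.
Qed.

Lemma curvature_parallel X Y : curvature nabla X Y P = wedge_endo g X Y P.
Proof.
have conn := lc_connection nablaLC.
rewrite /curvature !nabla_parallel dual_form_closed.
rewrite !(conn_add conn) !(conn_leibniz conn) !nabla_parallel.
rewrite -(lc_torsion_free nablaLC) scalerBl.
apply: vf_ext => p f; rewrite /wedge_endo /=; ring.
Qed.

Lemma dual_form_curvature X Y U :
  dual_form g P (curvature nabla X Y U) = dual_form g P (wedge_endo g X Y U).
Proof.
apply: (addIr (met g U (curvature nabla X Y P))).
rewrite /dual_form (curvature_skew _ _ nablaLC).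
by rewrite curvature_parallel wedge_skew.
Qed.

Variables a b : M -> R.
Hypothesis fluid : perfect_fluid g nabla P a b.

Lemma ricci_derivation U V U' V' p : met g U' V + met g U V' = 0 ->
  - ricci nabla U' V p - ricci nabla U V' p =
  - b p * (dual_form g P U' p * dual_form g P V p +
           dual_form g P U p * dual_form g P V' p).
Proof.
move=> /(congr1 (fun h : Cinf M => h p)); rewrite CinfDE Cinf0E => /eqP.
rewrite addr_eq0 => /eqP skew; rewrite !fluid skew; ring.
Qed.

Lemma Rdot_ricci_Qtensor U V X Y p :
  Rdot nabla (ricci nabla) U V X Y p = Qtensor g (ricci nabla) U V X Y p.
Proof.
rewrite /Rdot /Qtensor !ricci_derivation ?wedge_skew ?(curvature_skew _ _ nablaLC) //.
by rewrite !dual_form_curvature.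
Qed.

End ParallelField.

Theorem theorem5p1 (R : realType) (n : nat) (hn : (3 <= n)%N)
    (M : smoothManifold R n) (g : lorentzMetric M)
    (nabla : vectorField M -> vectorField M -> vectorField M)
    (hnabla : is_levi_civita g nabla)
    (P : vectorField M) (hP : unit_timelike g P)
    (hP1 : is_P_connection (semi_symmetric_conn g nabla P) P)
    (a b : M -> R) (hfluid : perfect_fluid g nabla P a b) :
  ricci_pseudo_symmetric_constant_type g nabla /\
  (forall (U V X Y : vectorField M) (p : M),
     Rdot nabla (ricci nabla) U V X Y p = Qtensor g (ricci nabla) U V X Y p).
Proof.
have RQ := Rdot_ricci_Qtensor _ _ hnabla _ hP hP1 _ _ hfluid.
split; last exact: RQ.
exists (fun=> 1); last by exists 1.
by move=> p _ U V X Y; rewrite mul1r.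
Qed.
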